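(* Let $f=f(\xi_+,\xi_-)\in\mathbb{C}[\xi_+,\xi_-]$ be a polynomial in the (central, commuting) separated variables $\xi_\pm=\tfrac12\bigl(x_0\pm\sqrt{(x_0)^2-\tfrac{4}{[2]^2}\,x^2}\bigr)$. Then the gradient of $f$ in the (extended) noncommutative differential calculus on quantum Minkowski space is $$\nabla f(\xi_+,\xi_-)=\frac{\partial_{q^2}f}{\partial_{q^2}\xi_+}\,\nabla\xi_+ +\frac{\partial_{q^2}f}{\partial_{q^2}\xi_-}\,\nabla\xi_-\,,$$ where the coefficients are the partial Jackson derivatives of $f$ with respect to $\xi_+$ and $\xi_-$.
   Context: Fix a real $q>0$, $q\neq1$. Put $\lambda=q-q^{-1}$, $[n]=\frac{q^n-q^{-n}}{q-q^{-1}}$, $(n)_{q^2}=\frac{q^{2n}-1}{q^2-1}$. Algebra. $\mathcal X$ (quantum Minkowski space) is the unital complex algebra generated by $x_0,x_-,x_+,x_3$ with relations: $x_0$ commutes with all generators; $q^{-1}x_-x_3-qx_3x_-=-\lambda x_-x_0$; $q^{-1}x_3x_+-qx_+x_3=-\lambda x_+x_0$; $x_-x_+-x_+x_--\lambda x_3x_3=-\lambda x_3x_0$. It is graded by degree. Put $x_{3\setminus0}:=x_3-x_0$ and $x^2:=(x_0)^2+q^{-1}x_-x_++qx_+x_--(x_3)^2$. The center of $\mathcal X$ is $Z=\mathbb{C}[x_0,x^2]$ (a polynomial ring). Calculus. Let $e_0,e_-,e_+,e_3$ be the standard basis of $\mathbb{C}^4$; column vectors in $\mathcal X^4$ are indexed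 by $\mu\in\{0,-,+,3\}$. Put $e_{--}=[2]^{1/2}e_-$, $e_{-+}=q^{1/2}(e_3-e_0)$, $e_{+-}=q^{-1/2}e_3+q^{3/2}e_0$, $e_{++}=[2]^{1/2}e_+$ (spinor basis). Define $2\times2$ matrices over $\mathcal X$ $$B_{x_0}=\begin{pmatrix}\frac{[4]}{[2]^2}x_0+\frac{\lambda}{q[2]}x_3&q^{-1/2}\lambda[2]^{-1/2}x_+\\-q^{1/2}\lambda[2]^{-1/2}x_-&\frac{[4]}{[2]^2}x_0-\frac{q\lambda}{[2]}x_3\end{pmatrix},\quad B_{x_-}=\begin{pmatrix}x_-&q^{-1/2}\lambda[2]^{-1/2}x_{3\setminus0}\\0&x_-\end{pmatrix},$$ $$B_{x_+}=\begin{pmatrix}x_+&0\\-q^{1/2}\lambda[2]^{-1/2}x_{3\setminus0}&x_+\end{pmatrix},\quad B_{x_{3\setminus0}}=\begin{pmatrix}q^{-1}x_{3\setminus0}&0\\0&qx_{3\setminus0}\end{pmatrix},\quad B_{x_3}=B_{x_{3\setminus0}}+B_{x_0},$$ and, as block matrices with respect to the ordered basis $(e_{--},e_{-+},e_{+-},e_{++})$, $$L_{x_0}=\begin{pmatrix}B_{x_0}&0\\0&B_{x_0}\end{pmatrix},\; L_{x_-}=\begin{pmatrix}qB_{x_-}&q^{-1/2}\lambda[2]^{1/2}B_{x_3}\\0&q^{-1}B_{x_-}\end{pmatrix},\; L_{x_+}=\begin{pmatrix}q^{-1}B_{x_+}&0\\0&qB_{x_+}\end{pmatrix},\; L_{x_{3\setminus0}}=\begin{pmatrix}B_{x_{3\setminus0}}&q^{-1/2}\lambda[2]^{1/2}B_{x_+}\\0&B_{x_{3\setminus0}}\end{pmatrix}.$$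 These assignments extend to a unital algebra homomorphism $f\mapsto L_f$, $\mathcal X\to M_4(\mathcal X)$. Let $\Lambda:\mathcal X\to M_4(\mathcal X)$ be the algebra homomorphism with $\Lambda(f)=q^nL_f$ for $f$ homogeneous of degree $n$. The gradient $\nabla:\mathcal X\to\mathcal X^4$, with components $(\nabla f)^\mu=\partial^\mu\triangleright f$ (partial derivatives), is the unique linear map with $\nabla1=0$, $\nabla x_\alpha=e_\alpha$ ($\alpha\in\{0,-,+,3\}$) and $\nabla(fg)=(\nabla f)g+\Lambda(f)\nabla g$. Separated variables. Let $K=\mathbb{C}(\xi_+,\xi_-)$ be the rational function field, viewed as an extension of $Z$ through $x_0=\xi_++\xi_-$, $x^2=[2]^2\xi_+\xi_-$, so that $\sqrt{(x_0)^2-\tfrac4{[2]^2}x^2}:=\xi_+-\xi_-$ and $\xi_\pm=\frac12(x_0\pm\sqrt{(x_0)^2-\tfrac4{[2]^2}x^2})$. Let $\hat{\mathcal X}=\mathcal X\otimes_ZK$, in which $\xi_\pm$ are central. Put $b=\frac{[2]}2x_0$, $c=(x_0)^2+\frac{\lambda^2}{[2]^2}x^2$, $\sqrt{b^2-c}:=\frac\lambda2(\xi_+-\xi_-)$, and $\Pi_\pm=\frac12\bigl(1\pm\frac{L_{x_0}-b}{\sqrt{b^2-c}}\bigr)\in M_4(\hat{\mathcal X})$; these are complementary orthogonal idempotents. The calculus is extended to $\hat{\mathcal X}$ as follows: $\Lambda$ extends to the algebra homomorphism $\hat{\mathcal X}\to M_4(\hat{\mathcal X})$ with $\Lambda(g)=\Pi_+\,g(q^2\xi_+,\xi_-)+\Pi_-\,g(\xi_+,q^2\xi_-)$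 for $g\in K$, and $\nabla$ extends to the linear map $\hat{\mathcal X}\to\hat{\mathcal X}^4$ satisfying $\nabla(fg)=(\nabla f)g+\Lambda(f)\nabla g$. Partial Jackson derivatives on polynomials in $\xi_\pm$: $\frac{\partial_{q^2}}{\partial_{q^2}\xi_+}(\xi_+^m\xi_-^n)=(m)_{q^2}\xi_+^{m-1}\xi_-^n$, $\frac{\partial_{q^2}}{\partial_{q^2}\xi_-}(\xi_+^m\xi_-^n)=(n)_{q^2}\xi_+^m\xi_-^{n-1}$, extended linearly. *)

(* Defs.v *)
From HB Require Import structures.
From mathcomp Require Import all_boot all_order all_algebra fraction generic_quotient.
From mathcomp Require Import boolp reals complex.
From mathcomp Require Import mpoly ring.
Set Implicit Arguments.
Unset Strict Implicit.
Unset Printing Implicit Defensive.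
Import Order.TTheory GRing.Theory Num.Theory.
Local Open Scope ring_scope.
Local Open Scope complex_scope.

Inductive term (F G : Type) : Type :=
| Gen of G
| Cst of F
| Add of term F G & term F G
| Mul of term F G & term F G.
Arguments Gen {F G}.
Arguments Cst {F G}.

Declare Scope pres_scope.
Delimit Scope pres_scope with PT.
Bind Scope pres_scope with term.
Notation "s + t" := (Add s t) : pres_scope.
Notation "s * t" := (Mul s t) : pres_scope.

HB.instance Definition _ (F G : Type) := gen_eqMixin (term F G).
HB.instance Definition _ (F G : Type) := gen_choiceMixin (term F G).

(* The F-algebra generated by G subject to the relations rel is pres rel; cls   *)
(* sends an expression in the generators to its class.                         *)
Section Presentation.
Variables (F : comNzRingType) (G : Type) (rel : term F G -> term F G -> Prop).

(* The least congruence containing rel whose quotient is an F-algebra. *)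
Inductive cong : term F G -> term F G -> Prop :=
| cong_refl s : cong s s
| cong_sym s t : cong s t -> cong t s
| cong_trans t s u : cong s t -> cong t u -> cong s u
| cong_add s s' t t' : cong s s' -> cong t t' -> cong (s + t) (s' + t')
| cong_mul s s' t t' : cong s s' -> cong t t' -> cong (s * t) (s' * t')
| cong_rel s t : rel s t -> cong s t
| cong_addA s t u : cong (s + (t + u)) ((s + t) + u)
| cong_addC s t : cong (s + t) (t + s)
| cong_add0 s : cong (Cst 0 + s) s
| cong_addN s : cong (Cst (-1) * s + s) (Cst 0)
| cong_mulA s t u : cong (s * (t * u)) ((s * t) * u)
| cong_mul1 s : cong (Cst 1 * s) s
| cong_mulDl s t u : cong ((s + t) * u) (s * u + t * u)
| cong_mulDr s t u : cong (s * (t + u)) (s * t + s * u)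
| cong_cstD a b : cong (Cst (a + b)%R) (Cst a + Cst b)
| cong_cstM a b : cong (Cst (a * b)%R) (Cst a * Cst b)
| cong_cstC a s : cong (Cst a * s) (s * Cst a).

Definition congb (s t : term F G) : bool := `[< cong s t >].

Lemma congb_refl : reflexive congb.
Proof. by move=> s; apply/asboolP; apply: cong_refl. Qed.

Lemma congb_sym : ssrbool.symmetric congb.
Proof. by move=> s t; apply/asboolP/asboolP; apply: cong_sym. Qed.

Lemma congb_trans : transitive congb.
Proof.
move=> t s u /asboolP st /asboolP tu; apply/asboolP; exact: cong_trans st tu.
Qed.

Canonical cong_equiv := EquivRel congb congb_refl congb_sym congb_trans.

Definition pres : Type := {eq_quot congb}%qT.
HB.instance Definition _ := Choice.on pres.
HB.instance Definition _ := Quotient.on pres.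

Definition cls (t : term F G) : pres := (\pi_pres t)%qT.

Lemma clsP s t : cong s t <-> cls s = cls t.
Proof. by split=> [st|/eqmodP/asboolP //]; apply/eqmodP/asboolP. Qed.

Lemma cong_repr t : cong (repr (cls t)) t.
Proof. by apply/clsP; rewrite /cls reprK. Qed.

Lemma clsW (P : pres -> Prop) : (forall t, P (cls t)) -> forall x, P x.
Proof. by move=> h x; have := h (repr x); rewrite /cls reprK. Qed.

Definition pres_add (x y : pres) := cls (repr x + repr y).
Definition pres_mul (x y : pres) := cls (repr x * repr y).
Definition pres_opp (x : pres) := cls (Cst (-1) * repr x).
Definition pres_scale (a : F) (x : pres) := cls (Cst a * repr x).

Lemma cls_add s t : cls (s + t) = pres_add (cls s) (cls t).
Proof. by apply/clsP/cong_sym/cong_add; apply: cong_repr. Qed.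

Lemma cls_mul s t : cls (s * t) = pres_mul (cls s) (cls t).
Proof. by apply/clsP/cong_sym/cong_mul; apply: cong_repr. Qed.

Lemma pres_oppE x : pres_opp x = pres_mul (cls (Cst (-1))) x.
Proof. by elim/clsW: x => s; rewrite -cls_mul /pres_opp; apply/clsP/cong_mul; [exact: cong_refl|exact: cong_repr]. Qed.

Lemma pres_scaleE a x : pres_scale a x = pres_mul (cls (Cst a)) x.
Proof. by elim/clsW: x => s; rewrite -cls_mul /pres_scale; apply/clsP/cong_mul; [exact: cong_refl|exact: cong_repr]. Qed.

Fact pres_addA : associative pres_add.
Proof.
elim/clsW=> s; elim/clsW=> t; elim/clsW=> u.
by rewrite -!cls_add; apply/clsP/cong_addA.
Qed.

Fact pres_addC : commutative pres_add.
Proof.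
by elim/clsW=> s; elim/clsW=> t; rewrite -!cls_add; apply/clsP/cong_addC.
Qed.

Fact pres_add0 : left_id (cls (Cst 0)) pres_add.
Proof. by elim/clsW=> s; rewrite -cls_add; apply/clsP/cong_add0. Qed.

Fact pres_addN : left_inverse (cls (Cst 0)) pres_opp pres_add.
Proof.
by elim/clsW=> s; rewrite pres_oppE -cls_mul -cls_add; apply/clsP/cong_addN.
Qed.

HB.instance Definition _ :=
  GRing.isZmodule.Build pres pres_addA pres_addC pres_add0 pres_addN.

Fact pres_mulA : associative pres_mul.
Proof.
elim/clsW=> s; elim/clsW=> t; elim/clsW=> u.
by rewrite -!cls_mul; apply/clsP/cong_mulA.
Qed.

Fact pres_mul1l : left_id (cls (Cst 1)) pres_mul.
Proof. by elim/clsW=> s; rewrite -cls_mul; apply/clsP/cong_mul1. Qed.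

Fact pres_cstC a x : pres_mul (cls (Cst a)) x = pres_mul x (cls (Cst a)).
Proof. by elim/clsW: x => s; rewrite -!cls_mul; apply/clsP/cong_cstC. Qed.

Fact pres_mul1r : right_id (cls (Cst 1)) pres_mul.
Proof. by move=> x; rewrite -pres_cstC pres_mul1l. Qed.

Fact pres_mulDl : left_distributive pres_mul +%R.
Proof.
elim/clsW=> s; elim/clsW=> t; elim/clsW=> u; rewrite /GRing.add /=.
by rewrite -!(cls_mul, cls_add); apply/clsP/cong_mulDl.
Qed.

Fact pres_mulDr : right_distributive pres_mul +%R.
Proof.
elim/clsW=> s; elim/clsW=> t; elim/clsW=> u; rewrite /GRing.add /=.
by rewrite -!(cls_mul, cls_add); apply/clsP/cong_mulDr.
Qed.

HB.instance Definition _ := GRing.Zmodule_isPzRing.Build pres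
  pres_mulA pres_mul1l pres_mul1r pres_mulDl pres_mulDr.

Lemma clsD s t : cls (s + t) = cls s + cls t. Proof. exact: cls_add. Qed.
Lemma clsM s t : cls (s * t) = cls s * cls t. Proof. exact: cls_mul. Qed.
Lemma cls1 : cls (Cst 1) = 1. Proof. by []. Qed.
Lemma cls_cstD a b : cls (Cst (a + b)) = cls (Cst a) + cls (Cst b).
Proof. by rewrite -clsD; apply/clsP/cong_cstD. Qed.
Lemma cls_cstM a b : cls (Cst (a * b)) = cls (Cst a) * cls (Cst b).
Proof. by rewrite -clsM; apply/clsP/cong_cstM. Qed.
Lemma cls_cstC a (x : pres) : cls (Cst a) * x = x * cls (Cst a).
Proof. exact: pres_cstC. Qed.

Fact pres_scaleA a b (x : pres) :
  pres_scale a (pres_scale b x) = pres_scale (a * b) x.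
Proof. by rewrite !pres_scaleE cls_cstM; apply: mulrA. Qed.
Fact pres_scale1 : left_id 1 pres_scale.
Proof. by move=> x; rewrite pres_scaleE; apply: mul1r. Qed.
Fact pres_scaleDr : right_distributive pres_scale +%R.
Proof. by move=> a x y; rewrite !pres_scaleE; apply: mulrDr. Qed.
Fact pres_scaleDl (x : pres) : {morph pres_scale^~ x : a b / a + b}.
Proof. by move=> a b; rewrite !pres_scaleE cls_cstD; apply: mulrDl. Qed.

HB.instance Definition _ := GRing.Zmodule_isLmodule.Build F pres
  pres_scaleA pres_scale1 pres_scaleDr pres_scaleDl.

Lemma pres_scalerE a (x : pres) : a *: x = cls (Cst a) * x.
Proof. exact: pres_scaleE. Qed.

Fact pres_scalerAl a (x y : pres) : a *: (x * y) = (a *: x) * y.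
Proof. by rewrite !pres_scalerE mulrA. Qed.
Fact pres_scalerAr a (x y : pres) : a *: (x * y) = x * (a *: y).
Proof. by rewrite !pres_scalerE !mulrA cls_cstC. Qed.

Section Eval.
Variables (A : comPzRingType) (phi : {rmorphism F -> A}) (g : G -> A).

Fixpoint eval (t : term F G) : A :=
  match t with
  | Gen x => g x
  | Cst a => phi a
  | Add s t => eval s + eval t
  | Mul s t => eval s * eval t
  end.

Hypothesis eval_rel : forall s t, rel s t -> eval s = eval t.

Lemma eval_cong s t : cong s t -> eval s = eval t.
Proof.
elim=> //=.
- by move=> ? ? ? _ -> _ ->.
- by move=> ? ? ? ? _ -> _ ->.
- by move=> ? ? ? ? _ -> _ ->.
- by move=> *; rewrite addrA.
- by move=> *; rewrite addrC.
- by move=> *; rewrite rmorph0 add0r.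
- by move=> *; rewrite rmorphN rmorph1 rmorph0 mulN1r addNr.
- by move=> *; rewrite mulrA.
- by move=> *; rewrite rmorph1 mul1r.
- by move=> *; rewrite mulrDl.
- by move=> *; rewrite mulrDr.
- by move=> *; rewrite rmorphD.
- by move=> *; rewrite rmorphM.
- by move=> *; rewrite mulrC.
Qed.

Definition pres_eval (x : pres) : A := eval (repr x).

Lemma pres_evalE t : pres_eval (cls t) = eval t.
Proof. exact: eval_cong (cong_repr t). Qed.

Lemma pres_evalD x y : pres_eval (x + y) = pres_eval x + pres_eval y.
Proof. by elim/clsW: x => s; elim/clsW: y => t; rewrite -clsD !pres_evalE. Qed.
Lemma pres_evalM x y : pres_eval (x * y) = pres_eval x * pres_eval y.
Proof. by elim/clsW: x => s; elim/clsW: y => t; rewrite -clsM !pres_evalE. Qed.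
End Eval.

End Presentation.

Section QNumbers.
Variables (R : realType) (q : R).
Definition lam : R := q - q^-1.
Definition qnum (n : nat) : R := (q ^+ n - q ^- n) / (q - q^-1).
Definition qqnum (n : nat) : R := (q ^+ (2 * n) - 1) / (q ^+ 2 - 1).
End QNumbers.

(* The index set {0, -, +, 3}, in this order. *)
Definition i0 : 'I_4 := @Ordinal 4 0 isT.
Definition im : 'I_4 := @Ordinal 4 1 isT.
Definition ip : 'I_4 := @Ordinal 4 2 isT.
Definition i3 : 'I_4 := @Ordinal 4 3 isT.

Section Minkowski.
Variables (R : realType) (q : R).
Local Notation C := (complex R).
Local Notation lam := (lam q).

(* Differences are written s + (-1) t, since expressions have no opposite. *)
Local Notation X0 := (@Gen C 'I_4 i0).
Local Notation Xm := (@Gen C 'I_4 im).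
Local Notation Xp := (@Gen C 'I_4 ip).
Local Notation X3 := (@Gen C 'I_4 i3).
Local Notation k a := (Cst a%:C).

Inductive mink_rel : term C 'I_4 -> term C 'I_4 -> Prop :=
| mink_rel0 i : mink_rel (X0 * Gen i) (Gen i * X0)
| mink_rel_m3 :
    mink_rel (k q^-1 * (Xm * X3) + k (- q) * (X3 * Xm)) (k (- lam) * (Xm * X0))
| mink_rel_3p :
    mink_rel (k q^-1 * (X3 * Xp) + k (- q) * (Xp * X3)) (k (- lam) * (Xp * X0))
| mink_rel_mp :
    mink_rel (Xm * Xp + k (-1) * (Xp * Xm) + k (- lam) * (X3 * X3))
             (k (- lam) * (X3 * X0)).

Definition qmink : Type := pres mink_rel.
HB.instance Definition _ := GRing.PzRing.on qmink.
HB.instance Definition _ := GRing.Lmodule.on qmink.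

Fact qmink_nontrivial : (1 : qmink) != 0.
Proof.
have h s t : mink_rel s t ->
    eval (idfun : {rmorphism C -> C}) (fun=> 0) s = eval idfun (fun=> 0) t.
  by case=> * /=; rewrite !(mul0r, mulr0, addr0).
apply/eqP=> /clsP/(eval_cong h) /= /eqP; by rewrite oner_eq0.
Qed.

HB.instance Definition _ := GRing.PzSemiRing_isNonZero.Build qmink qmink_nontrivial.
HB.instance Definition _ :=
  GRing.Lmodule_isLalgebra.Build C qmink (@pres_scalerAl _ _ mink_rel).
HB.instance Definition _ :=
  GRing.Lalgebra_isAlgebra.Build C qmink (@pres_scalerAr _ _ mink_rel).

Definition x_ (i : 'I_4) : qmink := cls mink_rel (Gen i).
Definition x_30 : qmink := x_ i3 - x_ i0.
Definition x_sq : qmink :=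
  x_ i0 ^+ 2 + q^-1%:C *: (x_ im * x_ ip) + q%:C *: (x_ ip * x_ im) - x_ i3 ^+ 2.

Definition homogeneous (n : nat) (f : qmink) : Prop :=
  exists c : n.-tuple 'I_4 -> C,
    f = \sum_(w : n.-tuple 'I_4) c w *: \prod_(i <- w) x_ i.

End Minkowski.

Section Separated.
Variables (R : realType) (q : R).
Local Notation C := (complex R).
Local Notation X := (qmink q).
Local Notation P := {mpoly C[2]}.

Definition jp : 'I_2 := @Ordinal 2 0 isT.
Definition jm : 'I_2 := @Ordinal 2 1 isT.

Definition ratfun : fieldType := {fraction P}.
Definition cK (c : C) : ratfun := tofrac (c%:MP : P).
(* xi_+ and xi_- are the two variables, indexed by jp and jm. *)
Definition xiP : ratfun := tofrac ('X_jp : P).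
Definition xiM : ratfun := tofrac ('X_jm : P).

HB.instance Definition _ := GRing.RMorphism.copy cK
  (@tofrac P \o @mpolyC 2 C).

(* X (x)_Z K, with Z = C[x_0, x^2], is the universal algebra under X and K    *)
(* in which the images of X and K commute and the two images of Z agree; it   *)
(* is presented here by that property, the last two constructors identifying  *)
(* the generators x_0 and x^2 of Z with their images in K.                    *)
Inductive hat_rel : term C (X + ratfun) -> term C (X + ratfun) -> Prop :=
| hat_XD a b : hat_rel (Gen (inl (a + b)%R)) (Gen (inl a) + Gen (inl b))
| hat_XM a b : hat_rel (Gen (inl (a * b)%R)) (Gen (inl a) * Gen (inl b))
| hat_XC (c : C) : hat_rel (Gen (inl c%:A)) (Cst c)
| hat_KD a b : hat_rel (Gen (inr (a + b)%R)) (Gen (inr a) + Gen (inr b))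
| hat_KM a b : hat_rel (Gen (inr (a * b)%R)) (Gen (inr a) * Gen (inr b))
| hat_KC (c : C) : hat_rel (Gen (inr (cK c))) (Cst c)
| hat_comm a b : hat_rel (Gen (inl a) * Gen (inr b)) (Gen (inr b) * Gen (inl a))
| hat_x0 : hat_rel (Gen (inl (x_ q i0))) (Gen (inr (xiP + xiM)%R))
| hat_xsq : hat_rel (Gen (inl (x_sq q)))
                    (Gen (inr (cK (qnum q 2 ^+ 2)%:C * xiP * xiM)%R)).

Definition qhat : Type := pres hat_rel.
HB.instance Definition _ := GRing.PzRing.on qhat.
HB.instance Definition _ := GRing.Lmodule.on qhat.

Section HatNontrivial.
(* A one-dimensional representation of X over K, used only to see 1 != 0. *)
Let s : ratfun := xiP + xiM.
Let d : R := qnum q 2 ^+ 2 / (q + q^-1).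
Let chig (i : 'I_4) : ratfun := nth 0 [:: s; cK d%:C * xiP; xiM; s] i.

Let cKr := (cK \o real_complex R)%FUN.

Let chi_rel t u : mink_rel q t u -> eval cK chig t = eval cK chig u.
Proof.
have cV a : cKr (- a) = - cKr a by rewrite /cKr !rmorphN.
have cB a b : cKr (a - b) = cKr a - cKr b by rewrite /cKr !rmorphB.
by case=> [i|||] /=; rewrite -?[cK _%:C]/(cKr _) ?(cV, cB) ?rmorphN ?rmorph1 /chig /= /lam ?(cV, cB); ring.
Qed.

Let chi : X -> ratfun := pres_eval cK chig.

Let chiD a b : chi (a + b) = chi a + chi b.
Proof. exact: pres_evalD chi_rel _ _. Qed.
Let chiM a b : chi (a * b) = chi a * chi b.
Proof. exact: pres_evalM chi_rel _ _. Qed.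
Let chiC c : chi c%:A = cK c.
Proof.
rewrite pres_scalerE mulr1; exact: (pres_evalE chi_rel (Cst c)).
Qed.
Let chix i : chi (x_ q i) = chig i.
Proof. exact: (pres_evalE chi_rel (Gen i)). Qed.

Let chi_sq : chi (x_sq q) = cK (qnum q 2 ^+ 2)%:C * xiP * xiM.
Proof.
have chiZ c a : chi (c *: a) = cK c * chi a by rewrite -mulr_algl chiM chiC.
have chiN a : chi (- a) = - chi a.
  by rewrite -scaleN1r chiZ rmorphN rmorph1 mulN1r.
rewrite /x_sq !(chiD, chiN, expr2, chiM, chiZ, chix) /chig /=.
have -> : qnum q 2 * qnum q 2 = (q + q^-1) * d.
  rewrite /d; have [q0|q0] := eqVneq q 0.
    by rewrite /qnum q0 invr0 expr0n !(expr0n, invr0, subrr, mul0r, mulr0, addr0).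
  rewrite -expr2 [RHS]mulrC divfK //.
  apply/eqP => e.
  have : q ^+ 2 + 1 = 0 by rewrite -[RHS](mulr0 q) -e mulrDr divff // expr2.
  move/eqP; rewrite paddr_eq0 ?sqr_ge0 ?ler01 // oner_eq0 andbF //.
rewrite !rmorphM !rmorphD /=; ring.
Qed.

Lemma qhat_nontrivial : (1 : qhat) != 0.
Proof.
pose g (z : X + ratfun) := match z with inl a => chi a | inr b => b end.
have h t u : hat_rel t u -> eval cK g t = eval cK g u.
  case=> //= *; rewrite ?chiD ?chiM ?chiC ?chix ?chi_sq //.
  exact: mulrC.
apply/eqP => /clsP/(eval_cong h) /= /eqP; by rewrite rmorph1 rmorph0 oner_eq0.
Qed.
End HatNontrivial.

HB.instance Definition _ := GRing.PzSemiRing_isNonZero.Build qhat qhat_nontrivial.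
HB.instance Definition _ :=
  GRing.Lmodule_isLalgebra.Build C qhat (@pres_scalerAl _ _ hat_rel).
HB.instance Definition _ :=
  GRing.Lalgebra_isAlgebra.Build C qhat (@pres_scalerAr _ _ hat_rel).

Definition iotaX (a : X) : qhat := cls hat_rel (Gen (inl a)).
Definition iotaK (g : ratfun) : qhat := cls hat_rel (Gen (inr g)).

Fact iotaX_linear : linear iotaX.
Proof.
move=> c a b; rewrite /iotaX [RHS in _ = RHS](_ : _ = cls hat_rel (Cst c * Gen (inl a) + Gen (inl b))); last by rewrite clsD clsM -pres_scalerE.
apply/clsP.
apply: cong_trans (cong_rel (hat_XD _ _)) _; apply: cong_add (cong_refl _ _).
rewrite -mulr_algl; apply: cong_trans (cong_rel (hat_XM _ _)) _.
by apply: cong_mul (cong_refl _ _); apply/cong_rel/hat_XC.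
Qed.

Fact iotaX_monoid : monoid_morphism iotaX.
Proof.
split; last by move=> a b; rewrite -clsM; apply/clsP/cong_rel/hat_XM.
rewrite -[X in iotaX X]scale1r -[RHS](@cls1 _ _ hat_rel).
by apply/clsP/cong_rel/hat_XC.
Qed.

HB.instance Definition _ := GRing.isLinear.Build C X qhat _ iotaX iotaX_linear.
HB.instance Definition _ := GRing.isMonoidMorphism.Build X qhat iotaX iotaX_monoid.

Fact iotaK_monoid : monoid_morphism iotaK.
Proof.
split; last by move=> a b; rewrite -clsM; apply/clsP/cong_rel/hat_KM.
rewrite -(rmorph1 cK) -[RHS](@cls1 _ _ hat_rel).
by apply/clsP/cong_rel/hat_KC.
Qed.

Fact iotaK_nmod : nmod_morphism iotaK.
Proof.
split; last by move=> a b; rewrite -clsD; apply/clsP/cong_rel/hat_KD.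
rewrite -(rmorph0 cK); have -> : (0 : qhat) = cls hat_rel (Cst 0) by [].
by apply/clsP/cong_rel/hat_KC.
Qed.

HB.instance Definition _ := GRing.isNmodMorphism.Build ratfun qhat iotaK iotaK_nmod.
HB.instance Definition _ := GRing.isMonoidMorphism.Build ratfun qhat iotaK iotaK_monoid.

End Separated.

Section MatrixMaps.
Variables (F : comNzRingType) (A : algType F).

(* M_4(A) and A^4 carry the left scaling by A; the F-scalars act through      *)
(* c%:A = c *: 1, which is central in A.                                      *)
Definition scalar_preserving (L : A -> 'M[A]_4) : Prop :=
  forall c : F, L c%:A = (c%:A)%:M.

Definition clinear (grad : A -> 'cV[A]_4) : Prop :=
  forall (c : F) f g, grad (c *: f + g) = c%:A *: grad f + grad g.

Definition rmulv (v : 'cV[A]_4) (g : A) : 'cV[A]_4 := map_mx ( *%R^~ g) v.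

Definition twisted_leibniz (L : A -> 'M[A]_4) (grad : A -> 'cV[A]_4) : Prop :=
  forall f g, grad (f * g) = rmulv (grad f) g + L f *m grad g.

End MatrixMaps.

Section Calculus.
Variables (R : realType) (q : R).
Local Notation C := (complex R).
Local Notation X := (qmink q).
Local Notation Xhat := (qhat q).
Local Notation lam := (lam q).
Local Notation "[ 2 ]" := (qnum q 2).
Local Notation "[ 4 ]" := (qnum q 4).
Local Notation h := (Num.sqrt q).
Local Notation s2 := (Num.sqrt [2]).

Definition mx22 (T : Type) (a b c d : T) : 'M[T]_2 :=
  \matrix_(i < 2, j < 2) if i == 0 then if j == 0 then a else b
                         else if j == 0 then c else d.

Definition B_0 : 'M[X]_2 := mx22
  (([4] / [2] ^+ 2)%:C *: x_ q i0 + (lam / (q * [2]))%:C *: x_ q i3)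
  ((h^-1 * lam * s2^-1)%:C *: x_ q ip)
  ((- (h * lam * s2^-1))%:C *: x_ q im)
  (([4] / [2] ^+ 2)%:C *: x_ q i0 - (q * lam / [2])%:C *: x_ q i3).

Definition B_m : 'M[X]_2 := mx22
  (x_ q im) ((h^-1 * lam * s2^-1)%:C *: x_30 q)
  0         (x_ q im).

Definition B_p : 'M[X]_2 := mx22
  (x_ q ip)                               0
  ((- (h * lam * s2^-1))%:C *: x_30 q)    (x_ q ip).

Definition B_30 : 'M[X]_2 := mx22
  (q^-1%:C *: x_30 q) 0
  0                   (q%:C *: x_30 q).

Definition B_3 : 'M[X]_2 := B_30 + B_0.

Local Notation sc a := (a%:C%:A : X).

Definition L_0 : 'M[X]_4 := block_mx B_0 0 0 B_0.
Definition L_m : 'M[X]_4 :=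
  block_mx (sc q *: B_m) (sc (h^-1 * lam * s2) *: B_3) 0 (sc q^-1 *: B_m).
Definition L_p : 'M[X]_4 := block_mx (sc q^-1 *: B_p) 0 0 (sc q *: B_p).
Definition L_30 : 'M[X]_4 :=
  block_mx B_30 (sc (h^-1 * lam * s2) *: B_p) 0 B_30.

(* The columns are e_{--}, e_{-+}, e_{+-}, e_{++}. *)
Definition spinor_mx : 'M[C]_4 :=
  let e i : 'cV[C]_4 := delta_mx i 0 in
  \matrix_(i < 4, j < 4)
    (nth 0 [:: s2%:C *: e im;
               h%:C *: (e i3 - e i0);
               h^-1%:C *: e i3 + (q * h)%:C *: e i0;
               s2%:C *: e ip] j) i 0.

(* M acts on columns in the standard basis; N is the matrix of the same map in *)
(* the spinor basis: M e_j = \sum_i e_i N_ij, the e_j being the columns above. *)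
Definition spinor_repr (M N : 'M[X]_4) : Prop :=
  M *m map_mx (in_alg X) spinor_mx = map_mx (in_alg X) spinor_mx *m N.

Record is_Lmap (L : {rmorphism X -> 'M[X]_4}) : Prop := IsLmap {
  Lmap_scalar : scalar_preserving L;
  Lmap_x0 : spinor_repr (L (x_ q i0)) L_0;
  Lmap_xm : spinor_repr (L (x_ q im)) L_m;
  Lmap_xp : spinor_repr (L (x_ q ip)) L_p;
  Lmap_x30 : spinor_repr (L (x_30 q)) L_30 }.

Record is_Lambda (L Lam : {rmorphism X -> 'M[X]_4}) : Prop := IsLambda {
  Lambda_scalar : scalar_preserving Lam;
  Lambda_homogeneous n f : homogeneous n f -> Lam f = sc (q ^+ n) *: L f }.

Record is_gradient (Lam : X -> 'M[X]_4) (grad : X -> 'cV[X]_4) : Prop :=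
  IsGradient {
    gradient_linear : clinear grad;
    gradient1 : grad 1 = 0;
    gradient_x i : grad (x_ q i) = delta_mx i 0;
    gradient_mul : twisted_leibniz Lam grad }.

Local Notation sch a := (a%:C%:A : Xhat).

Definition b_ : X := ([2] / 2)%:C *: x_ q i0.

(* The chosen square root of b^2 - c, where c = x_0^2 + lam^2 / [2]^2 x^2; in K *)
(* one has b^2 - c = (lam / 2 (xi_+ - xi_-))^2 because [2]^2 - 4 = lam^2.       *)
Definition sqrt_bc : ratfun R := cK (lam / 2)%:C * (xiP R - xiM R).

Definition Pi_num (L : X -> 'M[X]_4) : 'M[Xhat]_4 :=
  iotaK q sqrt_bc^-1 *: map_mx (@iotaX R q) (L (x_ q i0) - b_%:M).
Definition Pi_p (L : X -> 'M[X]_4) : 'M[Xhat]_4 :=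
  sch (1 / 2) *: (1%:M + Pi_num L).
Definition Pi_m (L : X -> 'M[X]_4) : 'M[Xhat]_4 :=
  sch (1 / 2) *: (1%:M - Pi_num L).

Definition dilate (j : 'I_2) (p : {mpoly C[2]}) : {mpoly C[2]} :=
  p \mPo [tuple (if k == j then q ^+ 2 else 1)%:C *: 'X_k | k < 2].

Record extends_Lambda (L Lam : X -> 'M[X]_4)
    (Lamh : {rmorphism Xhat -> 'M[Xhat]_4}) : Prop := ExtendsLambda {
  Lambdah_scalar : scalar_preserving Lamh;
  Lambdah_X f : Lamh (iotaX f) = map_mx (@iotaX R q) (Lam f);
  (* every element of K is p / d with d != 0 *)
  Lambdah_K (p d : {mpoly C[2]}) : d != 0 ->
    Lamh (iotaK q (tofrac p / tofrac d)) =
      Pi_p L *m (iotaK q (tofrac (dilate jp p) / tofrac (dilate jp d)))%:M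
    + Pi_m L *m (iotaK q (tofrac (dilate jm p) / tofrac (dilate jm d)))%:M }.

Record extends_gradient (grad : X -> 'cV[X]_4) (Lamh : Xhat -> 'M[Xhat]_4)
    (gradh : Xhat -> 'cV[Xhat]_4) : Prop := ExtendsGradient {
  gradienth_linear : clinear gradh;
  gradienth_X f : gradh (iotaX f) = map_mx (@iotaX R q) (grad f);
  gradienth_mul : twisted_leibniz Lamh gradh }.

(* m - U_(j) is truncated when m j = 0, where the coefficient vanishes anyway. *)
Definition jackson (j : 'I_2) (p : {mpoly C[2]}) : {mpoly C[2]} :=
  \sum_(m <- msupp p) (p@_m * (qqnum q (m j))%:C) *: 'X_[m - U_(j)].

Definition at_xi (p : {mpoly C[2]}) : Xhat := iotaK q (tofrac p).

End Calculus.

(* Main.v *)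
(** Since [Pi_+ + Pi_- = 1], the matrices [a = xi_+^-1 Lambda(xi_+)] and
    [b = xi_-^-1 Lambda(xi_-)] satisfy [a + b = 1 + q^2], and
    [Lambda(xi_+ xi_-) = q^2 xi_+ xi_-] gives [b a = q^2]; hence
    [b (1 - a) = 1 - a] and [b (1 - b) = q^2 (1 - b)].  Comparing the Leibniz
    rule for [xi_+ xi_-] with the one for [xi_- xi_+] gives
    [xi_- (1 - b) grad xi_+ = xi_+ (1 - a) grad xi_-], an eigenvector of [b]
    for both [q^2] and [1], hence zero.  So [Lambda(xi_+)] multiplies [grad xi_+]
    by [q^2 xi_+] and [grad xi_-] by [xi_+], and symmetrically for [xi_-]; on
    monomials the Leibniz rule becomes the recursion of the Jackson numbers. *)
Require Import Defs.
From HB Require Import structures.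
From mathcomp Require Import all_boot all_order all_algebra fraction.
From mathcomp Require Import boolp reals complex.
From mathcomp Require Import mpoly.
Import Order.TTheory GRing.Theory Num.Theory.
Local Open Scope ring_scope.
Local Open Scope complex_scope.

(** * Central scalars and matrices over a noncommutative ring *)

Definition central {A : pzRingType} (z : A) : Prop := forall a, a * z = z * a.

Lemma scalemxAr_central {A : pzRingType} {m n p} (z : A) (M : 'M[A]_(m, n))
  (N : 'M[A]_(n, p)) : central z -> M *m (z *: N) = z *: (M *m N).
Proof.
move=> hz; apply/matrixP=> i j; rewrite !mxE mulr_sumr; apply: eq_bigr => k _.
by rewrite !mxE !mulrA hz.
Qed.

Lemma central_alg {F : comNzRingType} {A : algType F} (c : F) :
  central (c%:A : A).
Proof. by move=> a; rewrite mulr_algl mulr_algr. Qed.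

Lemma scaler_algA {F : comNzRingType} {A : algType F} {V : lmodType A}
  (s : F) (x : A) (v : V) : (s *: x) *: v = x *: (s%:A *: v).
Proof. by rewrite scalerA mulr_algr. Qed.

(** * The twisted Leibniz rule over an arbitrary algebra *)

Section TwistedGradient.
Variables (F : comNzRingType) (A : algType F).
Variables (Lam : {rmorphism A -> 'M[A]_4}) (grad : A -> 'cV[A]_4).
Hypothesis grad_mul : twisted_leibniz Lam grad.

Lemma rmulv_central (z : A) (v : 'cV[A]_4) : central z -> rmulv v z = z *: v.
Proof. by move=> hz; apply/matrixP=> i j; rewrite !mxE hz. Qed.

Lemma twisted_leibniz1 : grad 1 = 0.
Proof.
have := grad_mul 1 1; rewrite mulr1 rmorph1 mul1mx rmulv_central; last first.
  by move=> a; rewrite mulr1 mul1r.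
by rewrite scale1r -[LHS]addr0 => /addrI.
Qed.

(** Exchanging [(x, a)] with [(y, b)] preserves the hypotheses, so a second application treats
    [grad y]. The witnesses [s'], [x'], [y'] let [s - 1], [x] and [y] be cancelled. *)
Lemma gradient_eigenvector (s s' : F) (x y x' y' : A) (a b : 'M[A]_4) :
    s' * (s - 1) = 1 -> central x -> central y -> x' * x = 1 -> y' * y = 1 ->
    Lam x = x *: a -> Lam y = y *: b ->
    a + b = ((1 + s)%:A)%:M -> Lam (x * y) = (s%:A * (x * y))%:M ->
  Lam y *m grad x = y *: grad x /\ Lam x *m grad x = (s *: x) *: grad x.
Proof.
move=> hs hx hy xK yK hLx hLy hab hLxy.
have yI (m n : nat) : injective (fun v : 'M[A]_(m, n) => y *: v).
  by move=> v w /(congr1 ( *:%R y')); rewrite !scalerA yK !scale1r.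
have xI (m n : nat) : injective (fun v : 'M[A]_(m, n) => x *: v).
  by move=> v w /(congr1 ( *:%R x')); rewrite !scalerA xK !scale1r.
have ba : b *m a = (s%:A)%:M.
  apply/xI/yI => /=; rewrite -(scalemxAr_central x b a hx) scalemxAl -hLx -hLy.
  (* Rewriting the argument as [y * x] puts the matrix product in the order [b *m a]. *)
  transitivity (Lam (x * y)); first by rewrite -hx [RHS]rmorphM.
  by rewrite hLxy !scale_scalar_mx mulrA central_alg hx.
have ab1 : a + b = 1%:M + (s%:A)%:M by rewrite hab scalerDl scale1r raddfD.
have b1E : 1%:M - b = a - (s%:A)%:M.
  by apply/eqP; rewrite subr_eq addrAC eq_sym subr_eq ab1.
have a1E : 1%:M - a = b - (s%:A)%:M.
  by apply/eqP; rewrite subr_eq addrAC eq_sym subr_eq addrC ab1.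
have bsE : b *m (s%:A)%:M = s%:A *: b.
  by rewrite -scalemx1 scalemxAr_central ?mulmx1 //; apply: central_alg.
have b_ker_a : b *m (1%:M - a) = 1%:M - a.
  by rewrite mulmxBr mulmx1 ba a1E.
have b_ker_b : b *m (1%:M - b) = s%:A *: (1%:M - b).
  by rewrite {1}b1E mulmxBr ba bsE scalerBr scalemx1.
set v := grad x; set w := grad y.
have e : y *: ((1%:M - b) *m v) = x *: ((1%:M - a) *m w).
  have := grad_mul x y; rewrite -hx grad_mul !rmulv_central // hLx hLy.
  rewrite -!scalemxAl -/v -/w !mulmxBl !mul1mx !scalerBr => e.
  by apply/eqP; rewrite subr_eq addrAC eq_sym subr_eq e.
have bv : (1%:M - b) *m v = 0.
  (* Multiplication by [b] scales the left side of [e] by [s] and fixes the right side, so [s - 1]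
     kills [(1 - b) v]. *)
  have := congr1 (mulmx b) e; rewrite !scalemxAr_central // !mulmxA b_ker_a.
  rewrite b_ker_b -e => /yI /eqP; rewrite -scalemxAl -subr_eq0.
  rewrite -[X in _ - X]scale1r -scalerBl => /eqP /(congr1 ( *:%R s'%:A)).
  rewrite scaler0 scalerA -[X in _ - X]scale1r -scalerBl mulr_algl scalerA hs.
  by rewrite !scale1r.
have bvE : b *m v = v.
  by apply/esym/eqP; rewrite -subr_eq0 -{1}[v]mul1mx -mulmxBl bv.
split; first by rewrite hLy -scalemxAl bvE.
have /eqP := congr1 (mulmx^~ v) ab1; rewrite /= !mulmxDl mul1mx bvE addrC.
rewrite (inj_eq (addrI _)) mul_scalar_mx => /eqP av.
by rewrite hLx -scalemxAl av scalerA mulr_algr.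
Qed.

(** Since [Lam x] acts on [grad x] as [s *: x], one more factor [x] turns the coefficient [c] into
    [1 + s * c], the recursion of a geometric sum. *)
Lemma gradient_pow (s : F) (x : A) n : central x ->
    Lam x *m grad x = (s *: x) *: grad x ->
  grad (x ^+ n) = ((\sum_(i < n) s ^+ i) *: x ^+ n.-1) *: grad x.
Proof.
move=> hx hLx; elim: n => [|n IH].
  by rewrite expr0 twisted_leibniz1 big_ord0 !scale0r.
have hxn : central (x ^+ n) by move=> u; apply: commrX.
rewrite exprS grad_mul IH rmulv_central // scalemxAr_central; last first.
  by move=> u; rewrite -scalerAr -scalerAl; congr (_ *: _); apply: commrX.
rewrite hLx scalerA -scalerDl big_ord_recl expr0; congr (_ *: _).
rewrite scalerDl scale1r -scalerAl -scalerAr scalerA; congr (_ + _).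
under [in RHS]eq_bigr do rewrite /bump /= exprSr.
(* At [n = 0] the truncated [n.-1] breaks [x ^+ n.-1 * x = x ^+ n], but there the empty sum makes
   the term vanish. *)
rewrite -mulr_suml; case: n {IH hxn} => [|n]; last by rewrite /= -exprSr.
by rewrite big_ord0 !mul0r !scale0r.
Qed.

(** With the powers of [x] on the left, [Lam (x ^+ m)] meets only multiples of [grad y], on which it
    acts as the scalar [x ^+ m]. *)
Lemma gradient_monomial (s : F) (x y : A) m n : central x -> central y ->
    Lam x *m grad x = (s *: x) *: grad x -> Lam x *m grad y = x *: grad y ->
    Lam y *m grad y = (s *: y) *: grad y ->
  grad (x ^+ m * y ^+ n) =
    ((\sum_(i < m) s ^+ i) *: (x ^+ m.-1 * y ^+ n)) *: grad x
  + ((\sum_(i < n) s ^+ i) *: (x ^+ m * y ^+ n.-1)) *: grad y.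
Proof.
move=> hx hy hxx hxy hyy.
have hyn k : central (y ^+ k) by move=> u; apply: commrX.
have Lxm : Lam (x ^+ m) *m grad y = x ^+ m *: grad y.
  elim: m => [|m IH]; first by rewrite !expr0 rmorph1 mul1mx scale1r.
  rewrite exprS [Lam _]rmorphM -mulmxA IH scalemxAr_central; last first.
    by move=> u; apply: commrX.
  by rewrite hxy scalerA -exprSr exprS.
rewrite grad_mul (gradient_pow s) // (gradient_pow s y n) // rmulv_central //.
congr (_ + _); first by rewrite scalerA -scalerAr -hyn.
rewrite scalemxAr_central; last first.
  by move=> u; rewrite -scalerAr -scalerAl hyn.
by rewrite Lxm scalerA -scalerAl -hyn.
Qed.

Lemma clinear_sum (I : Type) (r : seq I) (c : I -> F) (u : I -> A) :
  clinear grad ->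
  grad (\sum_(i <- r) c i *: u i) = \sum_(i <- r) (c i)%:A *: grad (u i).
Proof.
move=> grad_linear; elim: r => [|i r IH].
  rewrite !big_nil; have := grad_linear 1 0 0.
  by rewrite !scale1r addr0 -[LHS]addr0 => /addrI.
by rewrite !big_cons grad_linear IH.
Qed.
End TwistedGradient.

(** * Polynomials in the separated variables *)

Section SeparatedVariables.
Variables (R : realType) (q : R).
Local Notation C := (complex R).

Lemma iotaK_cK (c : C) : iotaK q (cK c) = c%:A.
Proof. by rewrite pres_scalerE mulr1; apply/clsP/cong_rel/hat_KC. Qed.

(** Induction on a representing expression: [hat_comm] covers generators from the Minkowski algebra,
    commutativity of [ratfun] the others, and commuting with a fixed element survives sums and
    products. *)
Lemma iotaK_central (g : ratfun R) : central (iotaK q g).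
Proof.
elim/clsW; elim=> [[a|h]|c|t IHt u IHu|t IHt u IHu].
- by rewrite /iotaK -!clsM; apply/clsP/cong_rel/hat_comm.
- by rewrite -/(iotaK q h) -!rmorphM mulrC.
- by rewrite cls_cstC.
- by rewrite clsD mulrDl mulrDr IHt IHu.
- by rewrite clsM -mulrA IHu mulrA IHt mulrA.
Qed.

Lemma at_xiM : {morph at_xi q : f g / f * g}.
Proof. by move=> f g; rewrite /at_xi !rmorphM. Qed.

Lemma at_xiX (f : {mpoly C[2]}) n : at_xi q (f ^+ n) = at_xi q f ^+ n.
Proof. by rewrite /at_xi !rmorphXn. Qed.

Lemma at_xiZ (c : C) (f : {mpoly C[2]}) : at_xi q (c *: f) = c *: at_xi q f.
Proof.
by rewrite -mul_mpolyC at_xiM [at_xi q c%:MP]iotaK_cK mulr_algl.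
Qed.

Lemma at_xi_sum (I : Type) (r : seq I) (u : I -> {mpoly C[2]}) :
  at_xi q (\sum_(i <- r) u i) = \sum_(i <- r) at_xi q (u i).
Proof. by rewrite /at_xi !rmorph_sum. Qed.

Lemma at_xi_monomial (m : 'X_{1..2}) :
  at_xi q 'X_[m] = iotaK q (xiP R) ^+ m jp * iotaK q (xiM R) ^+ m jm.
Proof.
have e0 : ord0 = jp by apply: val_inj.
have e1 : lift ord0 ord0 = jm by apply: val_inj.
by rewrite mpolyXE_id big_ord_recl big_ord1 e1 e0 at_xiM !at_xiX.
Qed.

(** A geometric sum; positivity and [q != 1] give [q ^+ 2 != 1]. It identifies the Jackson numbers
    with the coefficients in [gradient_monomial]. *)
Lemma qqnum_sum n : 0 < q -> q != 1 ->
  (qqnum q n)%:C = \sum_(i < n) (q ^+ 2)%:C ^+ i.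
Proof.
move=> q0 q1; rewrite /qqnum exprM subrX1 mulrC mulKf; last first.
  by rewrite subr_eq0 sqrp_eq1 // ltW.
by rewrite rmorph_sum; apply: eq_bigr => i _; rewrite rmorphXn.
Qed.

Lemma Pi_sum (L : qmink q -> 'M[qmink q]_4) : Pi_p L + Pi_m L = 1%:M.
Proof.
rewrite /Pi_p /Pi_m -scalerDr addrACA subrr addr0 scalerDr -!scalerDl.
by rewrite -rmorphD -splitr rmorph1 !scale1r.
Qed.

Lemma dilate1 j : dilate q j 1 = 1.
Proof. by rewrite /dilate rmorph1. Qed.

Lemma dilateX j k :
  dilate q j 'X_k = (if k == j then q ^+ 2 else 1)%:C *: 'X_k.
Proof. by rewrite /dilate comp_mpolyXU -tnth_nth tnth_mktuple. Qed.

Lemma dilateM j : {morph dilate q j : f g / f * g}.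
Proof. by move=> f g; rewrite /dilate rmorphM. Qed.

(** [Lambdah_K] speaks of fractions, and polynomials are those with denominator one. The form
    [d = 1] also admits the denominator [dilate q j 1]. *)
Lemma at_xi_div1 (f d : {mpoly C[2]}) :
  d = 1 -> iotaK q (tofrac f / tofrac d) = at_xi q f.
Proof. by move=> ->; congr (iotaK q _); rewrite tofrac1 divr1. Qed.

Lemma mulmx_central {A : nzRingType} {n} (M : 'M[A]_n) (z : A) :
  central z -> M *m z%:M = z *: M.
Proof. by move=> zC; rewrite -scalemx1 scalemxAr_central ?mulmx1. Qed.

Lemma extends_Lambda_poly (L Lam : qmink q -> 'M[qmink q]_4)
    (Lamh : {rmorphism qhat q -> 'M[qhat q]_4}) (f : {mpoly C[2]}) :
    extends_Lambda L Lam Lamh ->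
  Lamh (at_xi q f) = at_xi q (dilate q jp f) *: Pi_p L
                   + at_xi q (dilate q jm f) *: Pi_m L.
Proof.
move=> hLamh; have := Lambdah_K hLamh f (oner_neq0 {mpoly C[2]}).
rewrite (at_xi_div1 f 1 (erefl 1)) => ->; congr (_ + _).
  rewrite (at_xi_div1 _ _ (dilate1 jp)).
  exact/mulmx_central/iotaK_central.
rewrite (at_xi_div1 _ _ (dilate1 jm)).
exact/mulmx_central/iotaK_central.
Qed.

Lemma gradient_at_xi_monomial (L Lam : qmink q -> 'M[qmink q]_4)
    (Lamh : {rmorphism qhat q -> 'M[qhat q]_4})
    (gradh : qhat q -> 'cV[qhat q]_4) (m : 'X_{1..2}) :
    0 < q -> q != 1 -> extends_Lambda L Lam Lamh -> twisted_leibniz Lamh gradh ->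
  gradh (at_xi q 'X_[m]) =
    at_xi q ((qqnum q (m jp))%:C *: 'X_[m - U_(jp)]) *: gradh (iotaK q (xiP R))
  + at_xi q ((qqnum q (m jm))%:C *: 'X_[m - U_(jm)]) *: gradh (iotaK q (xiM R)).
Proof.
move=> q0 q1 hLamh hmul.
set s := (q ^+ 2)%:C; set x := iotaK q (xiP R); set y := iotaK q (xiM R).
have hs : (s - 1)^-1 * (s - 1) = 1.
  rewrite mulVf // subr_eq0 /s -(rmorph1 (real_complex R)) fmorph_eq.
  by rewrite sqrp_eq1 // ltW.
have xC : central x by apply: iotaK_central.
have yC : central y by apply: iotaK_central.
have xiVK k : iotaK q (tofrac ('X_k : {mpoly C[2]}))^-1 *
              iotaK q (tofrac ('X_k : {mpoly C[2]})) = 1.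
  by rewrite -rmorphM mulVf ?rmorph1 // tofrac_eq0 -msize_poly_eq0 msizeX.
have xE : x = at_xi q 'X_jp by [].
have yE : y = at_xi q 'X_jm by [].
(* On [Pi_p] the first variable is scaled by [s] and the second fixed; on [Pi_m] the reverse.
   Dividing out [x] and [y] leaves [a] and [b]. *)
pose a : 'M[qhat q]_4 := s%:A *: Pi_p L + Pi_m L.
pose b : 'M[qhat q]_4 := Pi_p L + s%:A *: Pi_m L.
have LxE : Lamh x = x *: a.
  rewrite xE (extends_Lambda_poly _ _ _ _ hLamh) !dilateX /= !at_xiZ !scale1r.
  by rewrite scalerDr; congr (_ + _); apply: scaler_algA.
have LyE : Lamh y = y *: b.
  rewrite yE (extends_Lambda_poly _ _ _ _ hLamh) !dilateX /= !at_xiZ !scale1r.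
  by rewrite scalerDr; congr (_ + _); apply: scaler_algA.
have ab : a + b = ((1 + s)%:A)%:M.
  rewrite /a /b [Pi_p L + _]addrC addrACA -scalerDr [Pi_m L + _]addrC Pi_sum.
  by rewrite scalemx1 -raddfD scalerDl scale1r addrC.
(* Both dilations scale the product by [s], so the two projections recombine into the identity. *)
have LxyE : Lamh (x * y) = (s%:A * (x * y))%:M.
  rewrite [x * y](_ : _ = at_xi q ('X_jp * 'X_jm)); last by rewrite at_xiM.
  rewrite (extends_Lambda_poly _ _ _ _ hLamh) !dilateM !dilateX /= !scale1r.
  rewrite -scalerAl -scalerAr !at_xiZ -scalerDr Pi_sum.
  by rewrite scalemx1 mulr_algl.
have [Lyx Lxx] := gradient_eigenvector _ _ _ _ hmul _ _ _ _ _ _ _ _ hs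
  xC yC (xiVK jp) (xiVK jm) LxE LyE ab LxyE.
have [Lxy Lyy] : Lamh x *m gradh y = x *: gradh y /\
                 Lamh y *m gradh y = (s *: y) *: gradh y.
  apply: (gradient_eigenvector _ _ _ _ hmul _ _ _ _ _ _ _ _ hs
    yC xC (xiVK jm) (xiVK jp) LyE LxE).
    by rewrite addrC.
  by rewrite xC.
rewrite at_xi_monomial (gradient_monomial _ _ _ _ hmul s) //.
by rewrite !at_xiZ !at_xi_monomial !qqnum_sum // !mnmBE !mnm1E /= !subn0 !subn1.
Qed.

End SeparatedVariables.

Theorem proposition3 (R : realType) (q : R) (hq : 0 < q) (hq1 : q != 1)
  (L Lam : {rmorphism qmink q -> 'M[qmink q]_4})
  (grad : qmink q -> 'cV[qmink q]_4)
  (Lamh : {rmorphism qhat q -> 'M[qhat q]_4})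
  (gradh : qhat q -> 'cV[qhat q]_4)
  (hL : is_Lmap L)
  (hLam : is_Lambda L Lam)
  (hgrad : is_gradient Lam grad)
  (hLamh : extends_Lambda L Lam Lamh)
  (hgradh : extends_gradient grad Lamh gradh)
  (f : {mpoly (complex R)[2]}) :
  gradh (at_xi q f) =
    at_xi q (jackson q jp f) *: gradh (iotaK q (xiP R))
  + at_xi q (jackson q jm f) *: gradh (iotaK q (xiM R)).
Proof.
case: hgradh => hlin _ hmul.
(* [jackson] and the monomial expansion both sum over the support of [f], so linearity reduces the
   claim to single monomials. *)
rewrite [in LHS](mpolyE f) /jackson !at_xi_sum !scaler_suml -big_split /=.
under eq_bigr do rewrite at_xiZ.
rewrite clinear_sum //; apply: eq_bigr => m _.
rewrite (gradient_at_xi_monomial _ _ _ _ _ _ m hq hq1 hLamh hmul) scalerDr !scalerA.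
by congr (_ *: _ + _ *: _); rewrite mulr_algl -at_xiZ scalerA.
Qed.
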